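(* Let $m\geqslant3$. Let $\psi$ be any positive function decreasing to $0$ as $t\to+\infty$, and let $\tau(\nu)$, $\nu=1,2,\dots$, be any sequence of natural numbers tending to infinity. Then there exists $\Theta=(\theta^1,\dots,\theta^m)\in\mathbb R^m$ with $1,\theta^1,\dots,\theta^m$ linearly independent over $\mathbb Z$ such that $\zeta_\nu\leqslant\psi(M_{\nu+\tau(\nu)})$ for the best approximation sequences of $\Theta$.
   Context: Here $\Theta$ is a $1\times m$ matrix, i.e. one linear form $L(\mathbf x)=\theta^1x_1+\dots+\theta^mx_m$, $\mathbf x\in\mathbb Z^m$. $\|\cdot\|$ = distance to nearest integer; $M(\mathbf x)=\max_i|x_i|$; $\zeta(\mathbf x)=\|L(\mathbf x)\|$. A nonzero $\mathbf x\in\mathbb Z^m$ is a best approximation if $\zeta(\mathbf x)\leqslant\zeta(\mathbf x')$ for all nonzero $\mathbf x'\in\mathbb Z^m$ with $M(\mathbf x')\leqslant M(\mathbf x)$. The values of $M$ and $\zeta$ at best approximations form sequences $M_1<M_2<\cdots$ and $\zeta_1>\zeta_2>\cdots$. *)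

(* Defs.v *)
From HB Require Import structures.
From mathcomp Require Import all_boot all_order all_algebra.
From mathcomp Require Import all_classical all_reals all_analysis.
Set Implicit Arguments.
Unset Strict Implicit.
Unset Printing Implicit Defensive.
Import Order.TTheory GRing.Theory Num.Theory.
Import numFieldNormedType.Exports.
Local Open Scope classical_set_scope.
Local Open Scope ring_scope.

Definition dist_int (R : realType) (t : R) : R :=
  inf [set `|t - k%:~R| | k in [set: int]].

Definition linear_form (R : realType) (m : nat) (Theta : 'rV[R]_m)
    (x : 'cV[int]_m) : R :=
  \sum_(i < m) Theta 0 i * (x i 0)%:~R.

Definition height (m : nat) (x : 'cV[int]_m) : nat :=
  \max_(i < m) `|x i 0%R|%N.

Definition zeta (R : realType) (m : nat) (Theta : 'rV[R]_m)
    (x : 'cV[int]_m) : R :=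
  dist_int (linear_form Theta x).

Definition best_approximation (R : realType) (m : nat) (Theta : 'rV[R]_m)
    (x : 'cV[int]_m) : Prop :=
  x != 0 /\
  forall x' : 'cV[int]_m, x' != 0 -> (height x' <= height x)%N ->
    zeta Theta x <= zeta Theta x'.

(* The sequences are indexed from 1; their values at index 0 are irrelevant.
   The last clause makes (M_ nu, zeta_ nu), nu >= 1, a complete list of the
   pairs (M(x), zeta(x)) over best approximations x, so that the two sequences
   are uniquely determined by Theta at all indices nu >= 1, whenever they
   exist. *)
Definition best_approximation_sequences (R : realType) (m : nat)
    (Theta : 'rV[R]_m) (M_ : nat -> nat) (zeta_ : nat -> R) : Prop :=
  [/\ forall nu : nat, (1 <= nu)%N -> (M_ nu < M_ nu.+1)%N,
      forall nu : nat, (1 <= nu)%N -> zeta_ nu.+1 < zeta_ nu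
    & forall (X : nat) (z : R),
        (exists nu : nat, [/\ (1 <= nu)%N, M_ nu = X & zeta_ nu = z]) <->
        (exists x : 'cV[int]_m,
           [/\ best_approximation Theta x, height x = X & zeta Theta x = z])].

Definition Z_independent_with_1 (R : realType) (m : nat) (Theta : 'rV[R]_m)
    : Prop :=
  forall (a : int) (x : 'cV[int]_m),
    a%:~R + linear_form Theta x = 0 -> a = 0 /\ x = 0.

(* Main.v *)
Require Import Defs.
From HB Require Import structures.
From mathcomp Require Import all_boot all_order all_algebra.
From mathcomp Require Import all_classical all_reals all_analysis.
From mathcomp Require Import lra ring zify.
Set Implicit Arguments.
Unset Strict Implicit.
Unset Printing Implicit Defensive.
Import Order.TTheory GRing.Theory Num.Theory.
Import numFieldNormedType.Exports.
Local Open Scope classical_set_scope.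
Local Open Scope ring_scope.

(* [Theta] is built as a limit of points [Theta_n], together with integer
   vectors [u_0, u_1, ...] such that the linear form takes integer values at
   both [u_n] and [u_(n+1)] when [Theta = Theta_n].  Since [m >= 3], one can
   move [Theta_n] slightly, keeping these two values fixed, to a point where a
   further independent vector [w'] also has an integer value; [u_(n+2)] is then
   chosen in the lattice spanned by [u_(n+1)] and [w'], and only afterwards
   [Theta] is moved by a tiny [t *: eta] with [eta] orthogonal to [u_(n+1)] and
   [u_(n+2)].  As [t] is chosen after [u_(n+2)], [zeta (u_n)] can be made
   smaller than [psi (height u_(n+2))].
   After that move the vectors of small height with small [zeta] lie in the
   rational plane of [u_n] and [u_(n+1)], on which the form is [t] times a
   functional vanishing at [u_(n+1)].  Choosing this functional as a rational
   approximation of an irrational one yields as many best approximations with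
   heights between those of [u_n] and [u_(n+1)] as desired, in particular more
   than [tau nu] for every [nu <= height u_n].  Hence, if
   [height u_k <= M_nu < height u_(k+1)], then
   [M_(nu + tau nu) <= height u_(k+2)] and
   [zeta_nu <= zeta u_k <= psi (height u_(k+2))]. *)

(** * Distance to the nearest integer and linear forms *)

Lemma dist_int_le (R : realType) (t : R) (k : int) :
  dist_int t <= `|t - k%:~R|.
Proof.
apply: ge_inf; last by exists k.
by exists 0 => _ [j _ <-].
Qed.

(** The infimum is attained at the floor [f] of [t + 1/2]: any other integer is at distance at least
    1 from [f], hence at least 1/2 from [t]. *)
Lemma dist_int_nearest (R : realType) (t : R) :
  exists2 k : int, dist_int t = `|t - k%:~R| & `|t - k%:~R| <= 2^-1.
Proof.
set f := Num.floor (t + 2^-1).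
have /andP[fl fr] : f%:~R <= t + 2^-1 < (f + 1)%:~R by exact: floor_itv.
rewrite intrD in fr.
have tf : `|t - f%:~R| <= 2^-1 by rewrite ler_norml; lra.
exists f => //; apply/le_anti/andP; split; first exact: dist_int_le.
apply: lb_le_inf; first by exists `|t - 0%:~R|, 0.
move=> _ [j _ <-]; have [->//|jf] := eqVneq j f.
apply: (le_trans tf).
have : 1 <= `|(j - f)%:~R : R|.
  by rewrite -intr_norm ler1z; move: jf; lia.
rewrite rmorphB /= => h.
have := ler_distD t j%:~R (f%:~R : R); rewrite [`|j%:~R - t|]distrC; lra.
Qed.

Lemma dist_int_ge0 (R : realType) (t : R) : 0 <= dist_int t.
Proof. by have [k ->] := dist_int_nearest t. Qed.

Lemma dist_int_lip (R : realType) (s t : R) :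
  `|dist_int s - dist_int t| <= `|s - t|.
Proof.
wlog le_ts : s t / dist_int t <= dist_int s => [hw|].
  have [|/ltW] := leP (dist_int t) (dist_int s); first exact: hw.
  by move=> le_st; rewrite distrC [leRHS]distrC; exact: hw.
rewrite ger0_norm ?subr_ge0//.
have [k -> _] := dist_int_nearest t.
have := dist_int_le s k; have := ler_distD t s k%:~R; lra.
Qed.

Lemma dist_intDl (R : realType) (s t : R) :
  s \is a Num.int -> dist_int (s + t) = dist_int t.
Proof.
suff le_D (u v : R) : u \is a Num.int -> dist_int (u + v) <= dist_int v.
  move=> sint; apply/le_anti; rewrite le_D//=.
  by rewrite -{1}[t](addKr s) le_D// rpredN.
move=> /intrP[j ->]; have [k -> _] := dist_int_nearest v.
by rewrite (le_trans (dist_int_le _ (j + k)))// intrD opprD addrACA subrr add0r.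
Qed.

Lemma dist_int_small (R : realType) (t : R) :
  `|t| <= 2^-1 -> dist_int t = `|t|.
Proof.
move=> t_small; apply/le_anti; apply/andP; split.
  by have := dist_int_le t 0; rewrite subr0.
have [k -> _] := dist_int_nearest t; have [->|k0] := eqVneq k 0.
  by rewrite subr0.
have : 1 <= `|k%:~R : R| by rewrite -intr_norm ler1z; move: k0; lia.
have := ler_distD t k%:~R 0; rewrite !subr0 [`|k%:~R - t|]distrC; lra.
Qed.

Lemma dist_int_eq0 (R : realType) (t : R) :
  (dist_int t == 0) = (t \is a Num.int).
Proof.
apply/eqP/idP => [|tint].
  have [k -> _] := dist_int_nearest t.
  by move/normr0_eq0/subr0_eq->; exact: intr_int.
by rewrite -[t]addr0 dist_intDl// dist_int_small normr0.
Qed.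

Lemma dist_int_continuous (R : realType) : continuous (@dist_int R).
Proof.
move=> t; apply/cvgrPdist_lt => e e0; near=> s.
by rewrite (le_lt_trans (dist_int_lip _ _))//; near: s; exact: cvgr_dist_lt.
Unshelve. all: by end_near. Qed.

Section LinearForm.
Context {R : realType} {m : nat}.
Implicit Types (Theta eta : 'rV[R]_m) (x : 'cV[int]_m).

Lemma linear_formDl Theta eta x :
  linear_form (Theta + eta) x = linear_form Theta x + linear_form eta x.
Proof.
by rewrite -big_split; apply: eq_bigr => i _; rewrite mxE mulrDl.
Qed.

Lemma linear_formZl (t : R) eta x :
  linear_form (t *: eta) x = t * linear_form eta x.
Proof. by rewrite mulr_sumr; apply: eq_bigr => i _; rewrite mxE mulrA. Qed.

Lemma linear_formDr Theta x y :
  linear_form Theta (x + y) = linear_form Theta x + linear_form Theta y.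
Proof.
by rewrite -big_split; apply: eq_bigr => i _; rewrite mxE intrD mulrDr.
Qed.

Lemma linear_formZr Theta (k : int) x :
  linear_form Theta (k *: x) = k%:~R * linear_form Theta x.
Proof.
by rewrite mulr_sumr; apply: eq_bigr => i _; rewrite mxE intrM mulrCA.
Qed.

Lemma linear_form0r Theta : linear_form Theta 0 = 0.
Proof. by rewrite /linear_form big1// => i _; rewrite mxE mulr0. Qed.

Lemma linear_form_delta Theta j :
  linear_form Theta (delta_mx j 0) = Theta 0 j.
Proof.
rewrite /linear_form (bigD1 j)//= mxE !eqxx mulr1 big1 ?addr0// => i ij.
by rewrite mxE (negPf ij) mulr0.
Qed.

Lemma linear_form_int_comb Theta (a b : int) x y :
  linear_form Theta x \is a Num.int -> linear_form Theta y \is a Num.int ->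
  linear_form Theta (a *: x + b *: y) \is a Num.int.
Proof.
by move=> *; rewrite linear_formDr !linear_formZr rpredD ?rpredM ?intr_int.
Qed.

Lemma linear_form_continuous x : continuous (fun Theta => linear_form Theta x).
Proof.
move=> Theta; rewrite /linear_form.
apply: (@cvg_big R _ _ 0 xpredT add_continuous _ (nbhs Theta)) => i _.
by apply: cvgMr_tmp; exact: coord_continuous.
Qed.

Lemma zeta_continuous x : continuous (fun Theta => zeta Theta x).
Proof.
move=> Theta.
apply: (@continuous_comp _ _ _ (fun T => linear_form T x) (@dist_int R)).
  exact: linear_form_continuous.
exact: dist_int_continuous.
Qed.

Lemma zeta_ge0 Theta x : 0 <= zeta Theta x.
Proof. exact: dist_int_ge0. Qed.

(** Comparing two vectors with integer values at [Theta] reduces, for small [t], to comparing [eta]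
    at them. *)
Lemma zeta_lineE Theta eta x (t : R) : linear_form Theta x \is a Num.int ->
  `|t * linear_form eta x| <= 2^-1 ->
  zeta (Theta + t *: eta) x = `|t| * `|linear_form eta x|.
Proof.
move=> xint small; rewrite /zeta linear_formDl linear_formZl dist_intDl//.
by rewrite dist_int_small// normrM.
Qed.

Lemma line_cvg Theta eta : Theta + t *: eta @[t --> (0:R)] --> Theta.
Proof.
suff : Theta + t *: eta @[t --> (0:R)] --> Theta + 0 *: eta.
  by rewrite scale0r addr0.
by apply: cvgD; [exact: cvg_cst | apply: cvgZr_tmp; exact: cvg_id].
Qed.

Lemma near_line Theta eta (P : set 'rV[R]_m) :
  nbhs Theta P -> \forall t \near 0^', P (Theta + t *: eta).
Proof. by move=> ThetaP; apply: cvg_within; exact: line_cvg ThetaP. Qed.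

Lemma near_small (c : R) : \forall t \near 0^', `|t * c| <= 2^-1.
Proof.
have h : t * c @[t --> (0 : R)] --> 0 * c.
  by apply: cvgMr_tmp; exact: cvg_id.
rewrite mul0r in h; have half0 : (0 : R) < 2^-1 by rewrite invr_gt0.
apply: cvg_within.
move/cvgrPdist_lt: h => /(_ _ half0).
by apply: filterS => t; rewrite sub0r normrN => /ltW.
Qed.

End LinearForm.

(** * Heights and the finiteness of the set of vectors of bounded height *)

Section Height.
Context {m : nat}.
Implicit Types (x : 'cV[int]_m) (H : nat).

Lemma leq_height x i : (`|x i 0%R| <= height x)%N.
Proof. exact: (leq_bigmax (F := fun i => `|x i 0%R|%N)). Qed.

Lemma height_eq0 x : (height x == 0)%N = (x == 0).
Proof.
apply/eqP/eqP => [h0|->].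
  apply/colP => i; rewrite mxE; apply/eqP; rewrite -absz_eq0 -leqn0.
  by rewrite (leq_trans (leq_height x i))// h0.
by apply/eqP; rewrite -leqn0; apply/bigmax_leqP => i _; rewrite mxE.
Qed.

Lemma height_finite H : exists s : seq 'cV[int]_m,
  forall x, (height x <= H)%N -> x \in s.
Proof.
pose f (g : {ffun 'I_m -> 'I_(H + H).+1}) : 'cV[int]_m :=
  \col_i ((g i : nat)%:Z - H%:Z).
exists [seq f g | g <- enum {: {ffun 'I_m -> 'I_(H + H).+1}}] => x xH.
apply/mapP; exists [ffun i => inord (absz (x i 0 + H%:Z))].
  by rewrite mem_enum.
apply/colP => i; rewrite mxE ffunE.
move: (x i 0 : int) (leq_trans (leq_height x i) xH) => z zH.
by rewrite inordK; lia.
Qed.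

Lemma near_seq {I : eqType} {T : Type} (F : set_system T) {FF : Filter F}
    (s : seq I) (P : I -> T -> Prop) :
  (forall i, i \in s -> \forall t \near F, P i t) ->
  \forall t \near F, forall i, i \in s -> P i t.
Proof.
elim: s => [|j s IH] sP; first by apply: filterE.
apply: filterS2 (sP j (mem_head _ _)) (IH _) => [t hj h i|i si].
  by rewrite inE => /predU1P[->|/h].
by apply: sP; rewrite inE si orbT.
Qed.

Lemma near_height {T : Type} (F : set_system T) {FF : Filter F} H
    (P : 'cV[int]_m -> T -> Prop) :
  (forall x, (height x <= H)%N -> \forall t \near F, P x t) ->
  \forall t \near F, forall x, (height x <= H)%N -> P x t.
Proof.
move=> hP; have [s sP] := height_finite H.
have : \forall t \near F, forall x,
    x \in [seq x <- s | height x <= H]%N -> P x t.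
  by apply: near_seq => x; rewrite mem_filter => /andP[/hP].
by apply: filterS => t h x xH; apply: h; rewrite mem_filter xH sP.
Qed.

End Height.

(** * Rational planes *)

Section RationalSpan.
Context {m : nat}.
Implicit Types (u w x y : 'cV[int]_m).

(* Membership in the rational plane, denominators cleared by [c]. *)
Definition in_span u w x :=
  exists c a b : int, c != 0 /\ c *: x = a *: u + b *: w.

Definition independent u w :=
  forall a b : int, a *: u + b *: w = 0 -> a = 0 /\ b = 0.

Let ratrow x : 'rV[rat]_m := \row_i (x i 0)%:~R.

Lemma in_span_rat u w x (D : 'rV[rat]_(1 + 1)) :
  ratrow x = D *m col_mx (ratrow u) (ratrow w) -> in_span u w x.
Proof.
move=> xE; pose d := D 0 (lshift 1 0); pose e := D 0 (rshift 1 0).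
exists (denq d * denq e), (numq d * denq e), (numq e * denq d).
split; first by rewrite mulf_neq0.
apply/colP => i; apply/eqP; rewrite !mxE -(eqr_int rat); apply/eqP.
have := congr1 (fun r : 'rV_m => r 0 i) xE.
rewrite !mxE big_split_ord !big_ord1 !col_mxEu !col_mxEd !mxE -/d -/e => xiE.
rewrite intrD !intrM xiE !numqE.
rewrite /=; ring.
Qed.

(** The columns of the cokernel matrix of [u] and [w] are rational functionals vanishing at both;
    one of them is nonzero at [x], and it is normalised. *)
Lemma separation (R : realType) u w x : ~ in_span u w x ->
  exists eta : 'rV[R]_m,
    [/\ linear_form eta u = 0, linear_form eta w = 0 & linear_form eta x = 1].
Proof.
move=> xNspan; set B := col_mx (ratrow u) (ratrow w).
have : ~~ (ratrow x <= B)%MS.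
  by apply/negP => /submxP[D /in_span_rat].
rewrite submxE => /eqP xB.
have [j xj] : exists j, (ratrow x *m cokermx B) 0 j != 0.
  case: (pickP (fun j => (ratrow x *m cokermx B) 0 j != 0)) => [j|h].
    by exists j.
  case: xB; apply/rowP => j; rewrite [RHS]mxE.
  by apply/eqP/negbFE/h.
pose v : 'rV[R]_m := \row_i ratr (cokermx B i j).
have vE y : linear_form v y = ratr ((ratrow y *m cokermx B) 0 j).
  rewrite [in RHS]mxE rmorph_sum; apply: eq_bigr => i _.
  by rewrite !mxE rmorphM /= ratr_int mulrC.
have uB : ratrow u *m cokermx B = 0.
  apply/eqP; rewrite -submxE; apply/submxP; exists (row_mx 1%:M 0).
  by rewrite mul_row_col mul1mx mul0mx addr0.
have wB : ratrow w *m cokermx B = 0.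
  apply/eqP; rewrite -submxE; apply/submxP; exists (row_mx 0 1%:M).
  by rewrite mul_row_col mul1mx mul0mx add0r.
exists ((linear_form v x)^-1 *: v); rewrite !linear_formZl !vE.
have r0 : ratr ((0 : 'rV[rat]_m) 0 j) = 0 :> R by rewrite mxE rmorph0.
rewrite wB uB r0 !mulr0; split=> //.
by rewrite mulVf// fmorph_eq0.
Qed.

(** Otherwise the identity matrix, of rank at least 3, would lie in the row space of a matrix with
    two rows. *)
Lemma unit_vector_notin_span u w : (3 <= m)%N ->
  exists j, ~ in_span u w (delta_mx j 0).
Proof.
move=> m3; apply/existsNP => allspan.
set B := col_mx (ratrow u) (ratrow w).
suff : (1%:M <= B)%MS.
  move=> /mxrankS; rewrite mxrank1 => /leq_trans/(_ (rank_leq_row _)).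
  by rewrite leqNgt m3.
apply/row_subP => j; have [c [a [b [c0 ce]]]] := allspan j.
apply/submxP; exists (row_mx (a%:~R / c%:~R)%:M (b%:~R / c%:~R)%:M).
rewrite mul_row_col !mul_scalar_mx; apply/rowP => i; rewrite !mxE.
have /(congr1 (fun z : 'cV[int]_m => (z i 0)%:~R : rat)) := ce.
rewrite !mxE eqxx andbT intrD !intrM => cei.
have c0' : c%:~R != 0 :> rat by rewrite intr_eq0.
apply: (mulfI c0'); rewrite mulrDr !mulrA ![c%:~R * _ / _]mulrAC.
by rewrite divff// !mul1r -cei eq_sym; case: eqP.
Qed.

End RationalSpan.

(** * Long chains in a rational plane *)

Lemma sqrt2_irrational (R : realType) (a b : int) :
  a%:~R + b%:~R * Num.sqrt 2 = 0 :> R -> a = 0 /\ b = 0.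
Proof.
move=> ab0; have ab : (a ^+ 2)%:~R = (2 * b ^+ 2)%:~R :> R.
  have -> : (a ^+ 2)%:~R = (b%:~R * Num.sqrt 2) ^+ 2 :> R.
    by rewrite rmorphXn /=; have -> : a%:~R = - (b%:~R * Num.sqrt 2) :> R;
      [lra | rewrite sqrrN].
  by rewrite exprMn sqr_sqrtr// intrM rmorphXn /= mulrC.
have {}ab : (`|a| ^ 2 = 2 * `|b| ^ 2)%N.
  by have := congr1 absz (intr_inj ab); rewrite abszM !abszX.
have [b0|b0] := eqVneq b 0.
  by split=> //; move: ab; rewrite b0 /=; lia.
have bpos : (0 < `|b|)%N by rewrite absz_gt0.
(* The 2-adic valuation is even on the left and odd on the right. *)
have := congr1 (logn 2) ab.
rewrite lognM ?expn_gt0 ?bpos// !lognX (@logn_prime 2 2)//.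
by move=> /(congr1 odd); rewrite oddD !oddM.
Qed.

(** The powers of [sqrt 2 - 1], a number strictly between 0 and 1, stay in the ring generated by
    [sqrt 2]. *)
Lemma sqrt2_small (R : realType) (e : R) : 0 < e ->
  exists a b : int, 0 < `|a%:~R + b%:~R * Num.sqrt 2 : R| < e.
Proof.
move=> e0; pose q : R := Num.sqrt 2 - 1.
have s2 : Num.sqrt 2 * Num.sqrt 2 = 2 :> R by rewrite -expr2 sqr_sqrtr.
have s0 : 0 <= Num.sqrt 2 :> R by exact: sqrtr_ge0.
have q0 : 0 < q by rewrite /q; nra.
have q1 : q < 1 by rewrite /q; nra.
have [n qn] : exists n, q ^+ n < e.
  have : q ^+ n @[n --> \oo] --> 0 by apply: cvg_expr; rewrite gtr0_norm.
  by move=> /cvgr_lt/(_ e e0)[n _ h]; exists n; apply: h => /=.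
suff [a [b ab]] : exists a b : int, q ^+ n = a%:~R + b%:~R * Num.sqrt 2.
  by exists a, b; rewrite -ab gtr0_norm ?exprn_gt0.
elim: n {qn} => [|n [a [b ab]]]; first by exists 1, 0; rewrite mul0r addr0.
exists (2 * b - a), (a - b); rewrite exprSr ab !rmorphB /= rmorphM /= /q.
transitivity (b%:~R * (Num.sqrt 2 * Num.sqrt 2) - a%:~R
   + (a%:~R - b%:~R) * Num.sqrt 2 : R); first by ring.
by rewrite s2; ring.
Qed.

Lemma height_gap (R : realType) (m H : nat) (phi : 'cV[int]_m -> R) :
  exists2 e, 0 < e &
    forall x, (height x <= H)%N -> phi x != 0 -> e < `|phi x|.
Proof.
have : \forall e \near 0^'+, forall x, (height x <= H)%N ->
    phi x != 0 -> e < `|phi x|.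
  apply: near_height => x _; have [->|x0] := eqVneq (phi x) 0.
    by apply: filterE.
  by near=> e => _; near: e; apply: nbhs_right_lt; rewrite normr_gt0.
move=> h.
have [e [e0 he]] := filter_ex (filterI (nbhs_right_gt (0 : R)) h).
by exists e.
Unshelve. all: by end_near. Qed.

Section Chain.
Context {R : realType} {m : nat}.
Implicit Types (u w x : 'cV[int]_m) (p : nat -> 'cV[int]_m) (eta : 'rV[R]_m).

(* On the plane of [u] and [w] the functionals vanishing at [w] are all
   proportional, so one [p] can serve all of them. *)
Definition chain u w p T := forall i, (i < T)%N -> p i.+1 != 0 /\
  forall eta x, linear_form eta w = 0 -> linear_form eta u != 0 ->
    x != 0 -> in_span u w x -> (height x <= height (p i))%N ->
    `|linear_form eta (p i.+1)| < `|linear_form eta x|.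

Lemma scale_int_eq0 (c : int) x : c != 0 -> c *: x = 0 -> x = 0.
Proof.
move=> c0 /colP cx; apply/colP => i; have := cx i; rewrite !mxE => /eqP.
by rewrite mulf_eq0 (negPf c0) => /eqP.
Qed.

Lemma independent_neq0 u w : independent u w -> u != 0.
Proof.
move=> uw; apply/eqP => u0; have := uw 1 0.
by rewrite u0 scaler0 scale0r addr0 => /(_ erefl)[].
Qed.

Lemma dual_functional u w : independent u w ->
  exists eta, linear_form eta u = 1 /\ linear_form eta w = 0.
Proof.
(* The plane degenerates to a line here: both generators are [w]. *)
move=> uw; have [|eta [w0 _ u1]] := @separation m R w w u; last by exists eta.
move=> [c [a [b [c0]]]]; rewrite -scalerDl => cab.
have [] := uw c (- (a + b)); last by move/eqP: c0.
by rewrite cab scaleNr subrr.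
Qed.

(** The chain is built greedily for an irrational functional. It rests on finitely many strict
    inequalities, which survive a change to a nearby rational functional, and [w2] is taken in the
    kernel of the latter. *)
Lemma chain_exists w w' T : independent w w' ->
  exists p w2 (a b : int), [/\ w2 = a *: w + b *: w', b != 0,
    p 0%N = w /\ (forall i, (i <= T)%N -> (height (p i) <= height w2)%N),
    (forall i, exists c d : int, p i = c *: w + d *: w') &
    (forall i, in_span w w2 (p i)) /\ chain w w2 p T].
Proof.
move=> ww'.
have [eta1 [eta1w eta1w']] := dual_functional ww'.
have [|eta2 [eta2w' eta2w]] := @dual_functional w' w.
  by move=> a b; rewrite addrC => /ww'[].
(* [g s] with [s = sqrt 2] vanishes at no nonzero point of the plane and takes
   arbitrarily small values on the lattice; [g r] with [r] rational and close
   to [s] keeps the same inequalities and vanishes at [w2]. *)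
pose g (r : R) := eta1 + r *: eta2.
have gE r (a b : int) :
    linear_form (g r) (a *: w + b *: w') = a%:~R + b%:~R * r.
  rewrite linear_formDr !linear_formZr /g !linear_formDl !linear_formZl.
  by rewrite eta1w eta1w' eta2w eta2w' mulr0 addr0 add0r !mulr1.
pose s : R := Num.sqrt 2.
have gs0 x : x != 0 -> in_span w w' x -> linear_form (g s) x != 0.
  move=> x0 [c [a [b [c0 cx]]]]; apply: contra_neq x0 => gx0.
  have := congr1 (linear_form (g s)) cx.
  rewrite linear_formZr gx0 mulr0 gE => /esym/sqrt2_irrational[a0 b0].
  by move: cx; rewrite a0 b0 !scale0r addr0; exact: scale_int_eq0.
have /choice[f fP] H : exists q, (exists c d : int, q = c *: w + d *: w') /\
    q != 0 /\ forall x, x != 0 -> in_span w w' x -> (height x <= H)%N ->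
      `|linear_form (g s) q| < `|linear_form (g s) x|.
  have [e e0 he] := height_gap H (linear_form (g s)).
  have [c [d /andP[cd0 cde]]] := sqrt2_small e0.
  exists (c *: w + d *: w'); split; first by exists c, d.
  split.
    apply: contraTneq cd0 => q0.
    by have := gE s c d; rewrite q0 linear_form0r => <-; rewrite normr0 ltxx.
  move=> x x0 xs xH; rewrite gE (lt_trans cde)// he//.
  exact: gs0.
pose p i := iter i (fun q => f (height q)) w.
have pS i : p i.+1 = f (height (p i)) by [].
have pcd i : exists c d : int, p i = c *: w + d *: w'.
  case: i => [|i]; first by exists 1, 0; rewrite scale1r scale0r addr0.
  by rewrite pS; have [] := fP (height (p i)).
(* There is one step more than [chain] requires: the step [i = T] serves to bound [height (p T)] by
   [height w2]. *)
pose stable (i : 'I_T.+1) r := forall x, (height x <= height (p i))%N ->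
  `|linear_form (g s) (p i.+1)| < `|linear_form (g s) x| ->
  `|linear_form (g r) (p i.+1)| < `|linear_form (g r) x|.
have : \forall r \near s, forall i, stable i r.
  apply: (@filter_forall R _ stable (nbhs s)) => i; apply: near_height => x _.
  have cont y :
      (fun r => `|linear_form (g r) y|) @ s --> `|linear_form (g s) y|.
    suff h : linear_form (g r) y @[r --> s] --> linear_form (g s) y.
      exact: cvg_norm h.
    rewrite /g; under eq_fun do rewrite linear_formDl linear_formZl.
    rewrite linear_formDl linear_formZl.
    by apply: cvgD; [exact: cvg_cst | apply: cvgMr_tmp; exact: cvg_id].
  have [|_] := boolP (`|linear_form (g s) (p i.+1)| < `|linear_form (g s) x|);
    last by apply: filterE.
  have cvg_sub : `|linear_form (g r) x| - `|linear_form (g r) (p i.+1)|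
      @[r --> s] --> `|linear_form (g s) x| - `|linear_form (g s) (p i.+1)|.
    by apply: cvgB; exact: cont.
  rewrite -subr_gt0 => /(cvgr_gt _ cvg_sub).
  by apply: filterS => r; rewrite subr_gt0.
move=> /nbhs_ballP[e /= e0 he].
have [r] : exists r : rat, ratr r \in `]s, s + e[ by apply: rat_in_itvoo; lra.
rewrite in_itv /= => /andP[sr re].
have {he}he i x : (i < T.+1)%N -> (height x <= height (p i))%N -> x != 0 ->
    in_span w w' x ->
    `|linear_form (g (ratr r)) (p i.+1)| < `|linear_form (g (ratr r)) x|.
  move=> iT xH x0 xs; apply: (he (ratr r) _ (Ordinal iT)) => //=.
    by rewrite /ball /= ltr_norml; lra.
  by have [_ [_ ]] := fP (height (p i)); apply.
set n := numq r; set q := denq r.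
have q0 : q != 0 by exact: denq_neq0.
have rE : q%:~R * ratr r = n%:~R :> R.
  by rewrite -[ratr r]/(n%:~R / q%:~R) mulrC divfK// intr_eq0.
pose w2 := n *: w + (- q) *: w'.
have gw2 : linear_form (g (ratr r)) w2 = 0.
  by rewrite gE rmorphN /= mulNr rE subrr.
have w2_span : in_span w w' w2 by exists 1, n, (- q); rewrite scale1r.
have w2_neq0 : w2 != 0.
  by apply/eqP => /ww'[_ /eqP]; rewrite oppr_eq0 (negPf q0).
exists p, w2, n, (- q); split=> //; first by rewrite oppr_eq0.
  (* If [p i] were higher than [w2], then [p i.+1] would beat [w2], at which the functional is 0. *)
  split=> // i iT; rewrite leqNgt; apply/negP => /ltnW w2p.
  have := he i w2 iT w2p w2_neq0 w2_span.
  by rewrite gw2 normr0 normr_lt0.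
have p_span i : in_span w w2 (p i).
  have [c [d ->]] := pcd i.
  exists q, (c * q + d * n), (- d); split=> //.
  by rewrite /w2; apply/colP => k; rewrite !mxE; ring.
split=> // i iT; split; first by rewrite pS; have [_ []] := fP (height (p i)).
move=> eta x etaw2 etaw x0 xs xH.
(* Both functionals vanish at [w2], and [g (ratr r)] is 1 at [w]. *)
have proportional y : in_span w w2 y ->
    linear_form eta y = linear_form eta w * linear_form (g (ratr r)) y.
  move=> [c [a [b [c0 cy]]]]; have c0' : c%:~R != 0 :> R by rewrite intr_eq0.
  apply: (mulfI c0'); rewrite mulrCA -!linear_formZr cy.
  rewrite !linear_formDr !linear_formZr.
  rewrite etaw2 gw2 !mulr0 !addr0 mulrCA; congr (_ * _).
  have := gE (ratr r) 1 0; rewrite scale1r scale0r addr0 mul0r addr0 => ->.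
  by rewrite mulr1.
have x_span : in_span w w' x.
  have [c [a [b [c0 cx]]]] := xs.
  exists c, (a + b * n), (- (b * q)); split=> //.
  by rewrite cx /w2; apply/colP => k; rewrite !mxE; ring.
rewrite (proportional _ (p_span i.+1)) (proportional _ xs) !normrM.
rewrite ltr_pM2l ?normr_gt0//.
by apply: he => //; exact: ltnW.
Qed.

End Chain.
Arguments chain R {m}.

(** * Perturbation of the linear form *)

Section Perturbation.
Context {R : realType} {m : nat}.
Implicit Types (Theta eta : 'rV[R]_m) (u w x : 'cV[int]_m)
  (p : nat -> 'cV[int]_m).

(** Equivalently, every vector of height at most [H] with an integer value lies in the plane of [u]
    and [w]. The bound [H] makes this an open condition on [Theta]. *)
Definition generic Theta u w H := forall x,
  (height x <= H)%N -> ~ in_span u w x -> 0 < zeta Theta x.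

(** Each step forces a best approximation higher than [p i] and at most as high as [p i.+1]. *)
Definition descent Theta p T := forall i, (i < T)%N -> p i.+1 != 0 /\
  forall x, x != 0 -> (height x <= height (p i))%N ->
    zeta Theta (p i.+1) < zeta Theta x.

Lemma near_zeta_gt Theta x (c : R) : c < zeta Theta x ->
  \forall Theta' \near Theta, c < zeta Theta' x.
Proof. exact: (cvgr_gt _ (@zeta_continuous R m x Theta)). Qed.

Lemma near_zeta_lt Theta x (c : R) : zeta Theta x < c ->
  \forall Theta' \near Theta, zeta Theta' x < c.
Proof. exact: (cvgr_lt _ (@zeta_continuous R m x Theta)). Qed.

Lemma near_zeta_ltD Theta x y : zeta Theta x < zeta Theta y ->
  \forall Theta' \near Theta, zeta Theta' x < zeta Theta' y.
Proof.
move=> /midf_lt[]; set c := (_ + _) / 2 => xc cy.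
apply: filterS2 (near_zeta_lt xc) (near_zeta_gt cy) => Theta'.
exact: lt_trans.
Qed.

Lemma generic_near Theta u w H : generic Theta u w H ->
  \forall Theta' \near Theta, generic Theta' u w H.
Proof.
move=> gen; pose P x Theta' := ~ in_span u w x -> 0 < zeta Theta' x.
apply: (@near_height _ _ (nbhs Theta) _ H P) => x xH.
have [xs|xNs] := pselect (in_span u w x); first by apply: filterE => ? /(_ xs).
by apply: filterS (near_zeta_gt (gen x xH xNs)) => Theta' ? _.
Qed.

Lemma descent_near Theta p T : descent Theta p T ->
  \forall Theta' \near Theta, descent Theta' p T.
Proof.
move=> desc; pose Q (i : 'I_T) Theta' := forall x,
  (height x <= height (p i))%N -> x != 0 ->
  zeta Theta' (p i.+1) < zeta Theta' x.
have : \forall Theta' \near Theta, forall i, Q i Theta'.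
  apply: (@filter_forall _ _ Q (nbhs Theta)) => i; apply: near_height => x xH.
  have [->|x0] := eqVneq x 0; first by apply: filterE => ? /eqP.
  have pix := (desc i (ltn_ord i)).2 x x0 xH.
  by apply: filterS (near_zeta_ltD pix) => Theta' ? _.
apply: filterS => Theta' h i iT; split; first by have [] := desc i iT.
by move=> x x0 xH; exact: (h (Ordinal iT)).
Qed.

Lemma zeta_gt0 Theta x :
  (0 < zeta Theta x) = (linear_form Theta x \isn't a Num.int).
Proof. by rewrite lt0r zeta_ge0 andbT dist_int_eq0. Qed.

(** Vectors outside the plane are treated one at a time: a functional vanishing on the plane moves
    the offending value off the integers, and a small multiple of it preserves the inequalities
    already obtained. *)
Lemma generic_perturbation Theta u w H (U : set 'rV[R]_m) :
  open U -> U Theta -> exists eta,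
    [/\ linear_form eta u = 0, linear_form eta w = 0, U (Theta + eta) &
        generic (Theta + eta) u w H].
Proof.
move=> oU UTheta; have [s sP] := @height_finite m H.
suff [eta [eu ew Ueta h]] : exists eta, [/\ linear_form eta u = 0,
    linear_form eta w = 0, U (Theta + eta) &
    forall x, x \in s -> ~ in_span u w x -> 0 < zeta (Theta + eta) x].
  by exists eta; split=> // x /sP; exact: h.
elim: s {sP} => [|y s [eta [eu ew Ueta etas]]].
  by exists 0; rewrite addr0 -(scale0r 0) !linear_formZl !mul0r.
have [ys|yNs] := pselect (in_span u w y).
  exists eta; split=> // x; rewrite inE => /predU1P[-> /(_ ys)//|]; exact: etas.
have [ygt0|] := boolP (0 < zeta (Theta + eta) y).
  by exists eta; split=> // x; rewrite inE => /predU1P[->//|]; exact: etas.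
rewrite zeta_gt0 negbK => yint.
have [eta2 [eta2u eta2w eta2y]] := @separation m R u w y yNs.
have nearU : \forall t \near 0^', U (Theta + eta + t *: eta2).
  by apply: near_line; exact: open_nbhs_nbhs.
have nears : \forall t \near 0^', forall x, x \in s -> ~ in_span u w x ->
    0 < zeta (Theta + eta + t *: eta2) x.
  apply: near_seq => x xs.
  have [xspan|xNs] := pselect (in_span u w x).
    by apply: filterE => ? /(_ xspan).
  by apply: filterS (near_line eta2 (near_zeta_gt (etas x xs xNs))) => t ? _.
have neary : \forall t \near 0^', 0 < zeta (Theta + eta + t *: eta2) y.
  have t0 : \forall t \near 0^', t != 0 :> R by exact: nbhs_dnbhs_neq.
  apply: filterS2 t0 (near_small (linear_form eta2 y)) => t t0 t1.
  by rewrite zeta_lineE// eta2y normr1 mulr1 normr_gt0.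
have [t [[tU ts] ty]] := filter_ex (filterI (filterI nearU nears) neary).
exists (eta + t *: eta2); rewrite addrA; split=> //.
- by rewrite linear_formDl linear_formZl eu eta2u mulr0 addr0.
- by rewrite linear_formDl linear_formZl ew eta2w mulr0 addr0.
- by move=> x; rewrite inE => /predU1P[->//|]; exact: ts.
Qed.

(** At [Theta] each [p i] has [zeta] equal to 0. If [zeta Theta x] is positive, the strict
    inequality persists; otherwise [x] lies in the plane by genericity, and [chain] compares the two
    values, both linear in [|t|]. *)
Lemma descent_near_line Theta eta u w p T H :
  (forall i, (i <= T)%N -> (height (p i) <= H)%N) ->
  (forall i, (i <= T)%N -> linear_form Theta (p i) \is a Num.int) ->
  chain R u w p T -> generic Theta u w H ->
  linear_form eta w = 0 -> linear_form eta u != 0 ->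
  \forall t \near 0^', descent (Theta + t *: eta) p T.
Proof.
move=> pH pint pchain gen etaw etau.
pose Q (i : 'I_T) t := forall x, (height x <= height (p i))%N -> x != 0 ->
  zeta (Theta + t *: eta) (p i.+1) < zeta (Theta + t *: eta) x.
have : \forall t \near 0^', forall i, Q i t.
  apply: (@filter_forall _ _ Q (0^')) => i; apply: near_height => x xi.
  have iT := ltn_ord i; have xH := leq_trans xi (pH i (ltnW iT)).
  have [->|x0] := eqVneq x 0; first by apply: filterE => ? /eqP.
  have [xpos|] := boolP (0 < zeta Theta x).
    have px : zeta Theta (p i.+1) < zeta Theta x.
      rewrite (_ : zeta _ (p i.+1) = 0)//; apply/eqP.
      by rewrite dist_int_eq0 pint.
    by apply: filterS (near_line eta (near_zeta_ltD px)) => t ? _.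
  move=> xN; have xs : in_span u w x.
    by apply: contrapT => xNs; move: xN; rewrite (gen x xH xNs).
  move: xN; rewrite zeta_gt0 negbK => xint.
  have t0 : \forall t \near 0^', t != 0 :> R by exact: nbhs_dnbhs_neq.
  apply: filterS3 t0 (near_small (linear_form eta x))
    (near_small (linear_form eta (p i.+1))) => t t0 tx tp _.
  rewrite !zeta_lineE// ?pint// ltr_pM2l ?normr_gt0//.
  by apply: (pchain i iT).2.
apply: filterS => t h i iT; split; first by have [] := pchain i iT.
by move=> x x0 xH; exact: (h (Ordinal iT)).
Qed.

(* What must be known about [u] and [w] at [Theta] for a small move of [Theta]
   to turn [p] into a [descent]. *)
Record stage Theta u w p T : Prop := Stage {
  stage_independent : independent u w;
  stage_start : p 0%N = u;
  stage_span : forall i, in_span u w (p i);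
  stage_height : forall i, (i <= T)%N -> (height (p i) <= height w)%N;
  stage_int : forall i, (i <= T)%N -> linear_form Theta (p i) \is a Num.int;
  stage_int_end : linear_form Theta w \is a Num.int;
  stage_chain : chain R u w p T;
  stage_generic : generic Theta u w (height w) }.

Lemma linear_form_in_span0 eta u w x : in_span u w x ->
  linear_form eta u = 0 -> linear_form eta w = 0 -> linear_form eta x = 0.
Proof.
move=> [c [a [b [c0 cx]]]] eu ew; have := congr1 (linear_form eta) cx.
rewrite linear_formDr !linear_formZr eu ew !mulr0 addr0 => /eqP.
by rewrite mulf_eq0 intr_eq0 (negPf c0) => /eqP.
Qed.

Lemma independent_comb w w' (a b : int) : b != 0 -> independent w w' ->
  independent w (a *: w + b *: w').
Proof.
move=> b0 ww' c d; rewrite scalerDr !scalerA addrA -scalerDl => /ww'[].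
move=> ca /eqP; rewrite mulf_eq0 (negPf b0) orbF => /eqP d0.
by move: ca; rewrite d0 mul0r addr0.
Qed.

Lemma comb_form0 eta w w' (a b : int) : b != 0 -> linear_form eta w = 0 ->
  linear_form eta (a *: w + b *: w') = 0 -> linear_form eta w' = 0.
Proof.
move=> b0 ew /eqP; rewrite linear_formDr !linear_formZr ew mulr0 add0r.
by rewrite mulf_eq0 intr_eq0 (negPf b0) => /eqP.
Qed.

(** The order of quantifiers matters: [w2] and [p] depend on [w], [w'] and [T] only, so [Theta] and
    [U] may be chosen in terms of [height w2]. *)
Lemma stage_exists w w' T : independent w w' ->
  exists w2 p (a b : int), [/\ w2 = a *: w + b *: w', b != 0 &
    forall Theta (U : set 'rV[R]_m),
      linear_form Theta w \is a Num.int -> linear_form Theta w' \is a Num.int ->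
      open U -> U Theta -> exists2 Theta2, U Theta2 & stage Theta2 w w2 p T].
Proof.
move=> ww'.
have [p [w2 [a [b [w2E b0 [p0 ph] pcd [pspan pchain]]]]]] :=
  @chain_exists R m w w' T ww'.
exists w2, p, a, b; split=> // Theta U wint w'int oU UTheta.
have [eta [ew ew2 Ueta gen]] :=
  @generic_perturbation Theta w w2 (height w2) U oU UTheta.
have ew' : linear_form eta w' = 0 by move: ew2; rewrite w2E; exact: comb_form0.
have int2 : linear_form (Theta + eta) w \is a Num.int.
  by rewrite linear_formDl ew addr0.
have int2' : linear_form (Theta + eta) w' \is a Num.int.
  by rewrite linear_formDl ew' addr0.
exists (Theta + eta) => //; split=> //.
- by rewrite w2E; exact: independent_comb.
- by move=> i _; have [c [d ->]] := pcd i; exact: linear_form_int_comb.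
- by rewrite w2E; exact: linear_form_int_comb.
Qed.

Lemma near_open (P : set 'rV[R]_m) Theta : nbhs Theta P ->
  exists U, [/\ open U, U Theta & forall Theta', U Theta' -> nbhs Theta' P].
Proof.
by move=> ThetaP; exists P^°; split=> //; exact: open_interior.
Qed.

(** The conclusions hold on a whole neighbourhood of [Theta2], so later moves can be kept small
    enough not to destroy them. *)
Lemma stage_step (eps : nat -> R) Theta u w p T T2 (P : set 'rV[R]_m) :
  (3 <= m)%N -> (forall n, (0 < n)%N -> 0 < eps n) ->
  stage Theta u w p T -> nbhs Theta P ->
  exists Theta2 w2 p2, stage Theta2 w w2 p2 T2 /\
    \forall Theta' \near Theta2,
      [/\ P Theta', descent Theta' p T & zeta Theta' u <= eps (height w2)].
Proof.
move=> m3 eps0 [uw p0 pspan ph pint wint pchain gen] ThetaP.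
have w0 : w != 0.
  by apply: (@independent_neq0 m w u) => a b; rewrite addrC => /uw[].
have [j jNs] := unit_vector_notin_span u w m3.
have [eta1 [e1u e1w e1j]] := @separation m R u w _ jNs.
(* Move [Theta] inside the points having its values at [u] and [w] until its
   [j]-th coordinate is rational. *)
have [t [r [tP tgen tr]]] : exists t (r : rat),
    [/\ nbhs (Theta + t *: eta1) P, generic (Theta + t *: eta1) u w (height w) &
    ratr r = Theta 0 j + t].
  have near1 : \forall Theta' \near Theta, nbhs Theta' P.
    exact: nbhs_interior.
  have near_t : nbhs (0 : R) (fun t => t != 0 -> _) :=
    near_line eta1 (filterI near1 (generic_near gen)).
  have [e /= e0 he] := (nbhs_ballP _ _).1 (near_t _).
  have [r] : exists r : rat, ratr r \in `]Theta 0 j, Theta 0 j + e[.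
    by apply: rat_in_itvoo; rewrite ltrDl.
  rewrite in_itv /= => /andP[r1 r2]; exists (ratr r - Theta 0 j), r.
  have [] := he (ratr r - Theta 0 j); rewrite ?subrKC//.
    by rewrite /ball /= sub0r normrN ger0_norm; lra.
  by rewrite subr_eq0 gt_eqF.
set Theta1 := Theta + t *: eta1 in tP tgen.
have form1 x : in_span u w x -> linear_form Theta1 x = linear_form Theta x.
  move=> xs; rewrite linear_formDl linear_formZl.
  by rewrite (linear_form_in_span0 xs e1u e1w) mulr0 addr0.
have [w' [w'1 w'int]] : exists w', linear_form eta1 w' != 0 /\
    linear_form Theta1 w' \is a Num.int.
  (* The [j]-th coordinate of [Theta1] is [r], so its denominator clears the value. *)
  exists (denq r *: delta_mx j 0); rewrite !linear_formZr e1j mulr1.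
  rewrite intr_eq0 denq_neq0 linear_formDl linear_formZl e1j mulr1.
  rewrite linear_form_delta -tr.
  by rewrite mulrC divfK ?intr_eq0// intr_int.
have ww' : independent w w'.
  move=> a b ab; have := congr1 (linear_form eta1) ab.
  rewrite linear_form0r linear_formDr !linear_formZr e1w mulr0 add0r => /eqP.
  rewrite mulf_eq0 (negPf w'1) orbF intr_eq0 => /eqP b0; split=> //.
  move: ab; rewrite b0 scale0r addr0 => aw.
  by apply/eqP; apply: contra_neqT w0 => a0; exact: scale_int_eq0 aw.
have [w2 [p2 [a [b [w2E b0 next]]]]] := stage_exists T2 ww'.
(* [eta1] vanishes at [u] and [w] but not at [w2], so a relation would involve [u] and [w] alone. *)
have uNs : ~ in_span w w2 u.
  move=> [c [a2 [b2 [c0 cu]]]]; have := congr1 (linear_form eta1) cu.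
  rewrite w2E linear_formZr e1u mulr0 !(linear_formDr, linear_formZr) e1w.
  rewrite !mulr0 !add0r => /esym/eqP.
  rewrite !mulf_eq0 (negPf w'1) orbF !intr_eq0 (negPf b0) orbF => /eqP b20.
  have [] := uw c (- a2); last by move/eqP: c0.
  by rewrite cu b20 scale0r addr0 scaleNr subrr.
(* Moving along [eta] changes the value at [u] while keeping those at [w] and [w'] integers. *)
have [eta [ew ew2 eu]] := @separation m R w w2 u uNs.
have ew' : linear_form eta w' = 0 by move: ew2; rewrite w2E; exact: comb_form0.
have p1int i : (i <= T)%N -> linear_form Theta1 (p i) \is a Num.int.
  by move=> iT; rewrite form1 ?pint.
have w2pos : (0 < height w2)%N.
  rewrite lt0n height_eq0 w2E; apply/eqP => /ww'[_ /eqP].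
  by rewrite (negPf b0).
have eu0 : linear_form eta u != 0 by rewrite eu oner_neq0.
have desc := descent_near_line ph p1int pchain tgen ew eu0.
have zu : zeta Theta1 u < eps (height w2).
  rewrite (_ : zeta _ u = 0) ?eps0//; apply/eqP.
  by rewrite dist_int_eq0 -p0 p1int.
have [s [[sP sdesc] su]] := filter_ex (filterI (filterI
  (near_line eta (nbhs_interior tP)) desc) (near_line eta (near_zeta_lt zu))).
have near2 := filterI (filterI sP (descent_near sdesc)) (near_zeta_lt su).
have [U [oU UTheta2 Unear]] := near_open (near2 _ _).
have [| |//|//|Theta2 U2 stage2] := next (Theta1 + s *: eta) U.
- rewrite linear_formDl linear_formZl ew mulr0 addr0 form1//.
  by exists 1, 0, 1; rewrite scale0r add0r !scale1r.
- by rewrite linear_formDl linear_formZl ew' mulr0 addr0.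
exists Theta2, w2, p2; split=> //.
by apply: filterS (Unear _ U2) => Theta' [[? ?] /ltW ?].
Qed.

End Perturbation.

(** * Sequences of best approximations *)

Lemma seq_argmin {I : eqType} {R : realType} (f : I -> R) (s : seq I) (i0 : I) :
  i0 \in s -> exists2 i, i \in s & forall j, j \in s -> f i <= f j.
Proof.
elim: s i0 => [//|k s IH] i0 _; case: s IH => [_|l s IH].
  by exists k; rewrite ?mem_head// => j; rewrite inE => /eqP->.
have [i il imin] := IH l (mem_head _ _).
have [ki|ik] := leP (f k) (f i).
  exists k; rewrite ?mem_head// => j; rewrite inE => /predU1P[->//|/imin].
  exact: le_trans.
exists i; first by rewrite inE il orbT.
by move=> j; rewrite inE => /predU1P[->|/imin//]; exact: ltW.
Qed.

Section BestApproximations.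
Context {R : realType} {m : nat}.
Implicit Types (x y : 'cV[int]_m) (Theta : 'rV[R]_m).

Lemma best_approximation_below Theta y : y != 0 -> exists x,
  [/\ best_approximation Theta x, (height x <= height y)%N &
      zeta Theta x <= zeta Theta y].
Proof.
move=> y0; have [s sP] := @height_finite m (height y).
pose t := [seq x <- s | (x != 0) && (height x <= height y)%N].
have tP x : x != 0 -> (height x <= height y)%N -> x \in t.
  by move=> x0 xy; rewrite mem_filter x0 xy sP.
have [x xt xmin] := seq_argmin (zeta Theta) (tP y y0 (leqnn _)).
have [x0 xy] : x != 0 /\ (height x <= height y)%N.
  by move: xt; rewrite mem_filter => /andP[/andP[]].
exists x; split=> //; last by apply: xmin; exact: tP.
split=> // x' x'0 x'x; apply: xmin; apply: tP => //.
exact: leq_trans xy.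
Qed.

Lemma heightN x : height (- x) = height x.
Proof. by apply: eq_bigr => i _; rewrite mxE abszN. Qed.

(** If the two distances were equal, the form would be an integer at [x - y] or [x + y], which are
    nonzero because the heights differ. *)
Lemma best_approximation_strict Theta x y :
  (forall z, z != 0 -> 0 < zeta Theta z) ->
  best_approximation Theta x -> best_approximation Theta y ->
  (height x < height y)%N -> zeta Theta y < zeta Theta x.
Proof.
move=> pos [x0 _] [y0 ymin] xy; rewrite lt_neqAle ymin// ?(ltnW xy)// andbT.
have notint (e : int) : (e == 1) || (e == -1) ->
    linear_form Theta (x + e *: y) \isn't a Num.int.
  move=> e1; rewrite -zeta_gt0 pos//; apply: contraTneq xy => /eqP.
  rewrite addr_eq0 => /eqP ->.
  by case/orP: e1 => /eqP ->; rewrite ?scaleN1r ?scale1r ?opprK ?heightN ltnn.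
apply/eqP; rewrite /zeta.
have [k -> _] := dist_int_nearest (linear_form Theta x).
have [l -> _] := dist_int_nearest (linear_form Theta y).
move=> /eqP; rewrite eqr_norm2 => /orP[] /eqP yx.
- have /negP[] := notint (-1) isT.
  rewrite linear_formDr linear_formZr rmorphN /= mulN1r.
  have -> : linear_form Theta x - linear_form Theta y = (k - l)%:~R.
    by rewrite rmorphB /=; lra.
  exact: intr_int.
- have /negP[] := notint 1 isT.
  rewrite linear_formDr linear_formZr mul1r.
  have -> : linear_form Theta x + linear_form Theta y = (k + l)%:~R.
    by rewrite rmorphD /=; lra.
  exact: intr_int.
Qed.

(** The heights of best approximations are unbounded, so they can be enumerated increasingly; best
    approximations of equal height have equal [zeta]. *)
Lemma best_approximation_sequences_exist Theta :
  (forall x, x != 0 -> 0 < zeta Theta x) ->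
  (forall H, exists2 y, y != 0 &
    forall x, x != 0 -> (height x <= H)%N -> zeta Theta y < zeta Theta x) ->
  exists M_ zeta_, best_approximation_sequences Theta M_ zeta_.
Proof.
move=> pos inf.
pose B n := `[< exists x, best_approximation Theta x /\ height x = n >].
have Binf n : exists b, (n < b)%N && B b.
  have [y y0 yn] := inf n.
  have [x [xbest _ xy]] := best_approximation_below Theta y0.
  exists (height x); apply/andP; split; last by apply/asboolP; exists x.
  rewrite ltnNge; apply/negP => /(yn _ xbest.1).
  by rewrite ltNge xy.
(* The value 0 at index 0 lies below every height, so [M_ 1] is the least one. *)
pose M_ := fix M n := if n is n'.+1 then ex_minn (Binf (M n')) else 0%N.
have M_lt n : (M_ n < M_ n.+1)%N.
  by rewrite /=; case: ex_minnP => b /andP[].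
have M_B n : B (M_ n.+1) by rewrite /=; case: ex_minnP => b /andP[].
have M_min n b : (M_ n < b)%N -> B b -> (M_ n.+1 <= b)%N.
  by move=> nb Bb; rewrite /=; case: ex_minnP => c _; apply; rewrite nb.
have n_le_M n : (n <= M_ n)%N.
  by elim: n => [//|n IH]; exact: leq_ltn_trans IH (M_lt n).
have /choice[X XP] nu : exists x, (1 <= nu)%N ->
    best_approximation Theta x /\ height x = M_ nu.
  case: nu => [|nu]; first by exists 0.
  by have /asboolP[x] := M_B nu; exists x.
exists M_, (fun nu => zeta Theta (X nu)); split=> //.
  move=> nu nu1; have [b1 h1] := XP nu nu1; have [b2 h2] := XP nu.+1 isT.
  by apply: best_approximation_strict => //; rewrite h1 h2.
move=> h z; split=> [[nu [nu1 <- <-]]|[x [xbest <- <-]]].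
  by have [? ?] := XP nu nu1; exists (X nu).
have Bx : B (height x) by apply/asboolP; exists x.
have x0 : (0 < height x)%N by rewrite lt0n height_eq0 xbest.1.
have hit : exists n, (height x <= M_ n)%N by exists (height x).
have [[|n] xn nmin] := ex_minnP hit; first by move: xn; rewrite leqNgt x0.
have nx : (M_ n < height x)%N.
  by rewrite ltnNge; apply/negP => /nmin; rewrite ltnn.
have xE : M_ n.+1 = height x by apply/eqP; rewrite eqn_leq xn M_min.
exists n.+1; split=> //; have [[X0 Xmin] Xh] := XP n.+1 isT.
apply/le_anti/andP; split; first by apply: Xmin; rewrite ?xbest.1// Xh xE.
by apply: xbest.2; rewrite // Xh xE.
Qed.

Section Enumeration.
Context {Theta : 'rV[R]_m} {M_ : nat -> nat} {zeta_ : nat -> R}.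
Hypothesis seqs : best_approximation_sequences Theta M_ zeta_.

Lemma best_value nu : (1 <= nu)%N -> exists x,
  [/\ best_approximation Theta x, height x = M_ nu & zeta Theta x = zeta_ nu].
Proof. by case: seqs => _ _ h nu1; apply/h; exists nu. Qed.

Lemma leq_M nu : (1 <= nu)%N -> (nu <= M_ nu)%N.
Proof.
case: seqs => M_lt _ _.
elim: nu => // -[_ _|nu IH _]; last first.
  exact: leq_ltn_trans (IH isT) (M_lt nu.+1 isT).
by have [x [[x0 _] <- _]] := best_value (leqnn 1); rewrite lt0n height_eq0.
Qed.

(** [x] occurs in the list at some index [mu], and monotonicity forces [nu < mu]. *)
Lemma M_next nu x : (1 <= nu)%N -> best_approximation Theta x ->
  (M_ nu < height x)%N -> (M_ nu.+1 <= height x)%N.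
Proof.
case: seqs => M_lt _ hall nu1 xbest.
have [_ /(_ _)[|mu [mu1 <- _]]] := hall (height x) (zeta Theta x).
  by exists x.
have M_mono a b : (1 <= a)%N -> (a <= b)%N -> (M_ a <= M_ b)%N.
  move=> a1; elim: b => [|b IH]; first by rewrite leqn0 => /eqP->.
  rewrite leq_eqVlt => /predU1P[->//|]; rewrite ltnS => ab.
  by rewrite (leq_trans (IH ab))// ltnW// M_lt// (leq_trans a1).
have [|mu_nu] := ltnP nu mu; first by move=> ? _; exact: M_mono.
by rewrite ltnNge M_mono.
Qed.

Lemma descent_M p T nu i : descent Theta p T -> (1 <= nu)%N ->
  (M_ nu <= height (p 0%N))%N -> (i <= T)%N -> (M_ (nu + i) <= height (p i))%N.
Proof.
move=> desc nu1 nu0; elim: i => [|i IH] iT; first by rewrite addn0.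
have [p0 pmin] := desc i iT.
have [x [xbest xp zx]] := best_approximation_below Theta p0.
have px : (height (p i) < height x)%N.
  rewrite ltnNge; apply/negP => /(pmin _ xbest.1).
  by rewrite ltNge zx.
rewrite addnS (leq_trans _ xp)// M_next ?addn_gt0 ?nu1//.
exact: leq_ltn_trans (IH (ltnW iT)) px.
Qed.

End Enumeration.

End BestApproximations.

(** * Nested closed boxes *)

Definition closed_box {R : realType} {m : nat} (Theta : 'rV[R]_m) (r : R) :
  set 'rV[R]_m := [set Theta' | forall j, `|Theta' 0 j - Theta 0 j| <= r].

Section Boxes.
Context {R : realType} {m : nat}.
Implicit Types (Theta : 'rV[R]_m) (r : R).

Lemma nbhs_closed_box Theta r : 0 < r -> nbhs Theta (closed_box Theta r).
Proof.
move=> r0; apply/nbhs_ballP; exists r => //= Theta' [_ h] j.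
by have := h 0 j; rewrite /ball /= distrC => /ltW.
Qed.

Lemma closed_box_nbhs Theta (P : set 'rV[R]_m) : nbhs Theta P ->
  exists2 r, 0 < r & closed_box Theta r `<=` P.
Proof.
move=> /nbhs_ballP[e /= e0 eP]; exists (e / 2); first by rewrite divr_gt0.
move=> Theta' h; apply: eP; split=> // i j; rewrite ord1 /ball /= distrC.
by apply: le_lt_trans (h j) _; rewrite ltr_pdivrMr// ltr_pMr// ltr1n.
Qed.

(** In each coordinate every left endpoint is below every right endpoint, and the supremum of the
    left endpoints lies in all the intervals. *)
Lemma nested_boxes (c : nat -> 'rV[R]_m) (r : nat -> R) :
  (forall n, 0 < r n) ->
  (forall n, closed_box (c n.+1) (r n.+1) `<=` closed_box (c n) (r n)) ->
  exists Theta, forall n, closed_box (c n) (r n) Theta.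
Proof.
move=> r0 sub.
have mono k l : (k <= l)%N ->
    closed_box (c l) (r l) `<=` closed_box (c k) (r k).
  elim: l => [|l IH]; first by rewrite leqn0 => /eqP->.
  rewrite leq_eqVlt => /predU1P[->//|]; rewrite ltnS => kl.
  exact: subset_trans (sub l) (IH kl).
(* The inclusion of boxes is tested at the centre [c l] shifted by [s] in all coordinates. *)
have inside k l j (s : R) : (k <= l)%N -> `|s| <= r l ->
    `|c l 0 j + s - c k 0 j| <= r k.
  move=> kl sr; have := mono k l kl (c l + const_mx s).
  have box : closed_box (c l) (r l) (c l + const_mx s).
    by move=> i; rewrite !mxE addrAC subrr add0r.
  by move=> /(_ box j); rewrite !mxE.
have cross k l j : c k 0 j - r k <= c l 0 j + r l.
  have [kl|/ltnW lk] := leqP k l.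
    have := inside k l j (r l) kl.
    rewrite gtr0_norm// lexx ler_norml => /(_ isT) /andP[]; lra.
  have := inside l k j (- r k) lk.
  rewrite normrN gtr0_norm// lexx ler_norml => /(_ isT) /andP[]; lra.
pose E j := range (fun n => c n 0 j - r n).
exists (\row_j sup (E j)) => n j; rewrite mxE.
have low : c n 0 j - r n <= sup (E j).
  apply: ub_le_sup; last by exists n.
  by exists (c 0%N 0 j + r 0%N) => _ [k _ <-].
have up : sup (E j) <= c n 0 j + r n.
  apply: ge_sup; first by exists (c 0%N 0 j - r 0%N), 0%N.
  by move=> _ [k _ <-].
by rewrite ler_norml; apply/andP; split; lra.
Qed.

End Boxes.

(** * Construction of the linear form *)

Lemma height_delta (m : nat) (j : 'I_m) :
  height (delta_mx j 0 : 'cV[int]_m) = 1%N.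
Proof.
apply/eqP; rewrite eqn_leq; apply/andP; split.
  by apply/bigmax_leqP => i _; rewrite mxE; case: (_ && _).
by have := leq_height (delta_mx j 0) j; rewrite mxE !eqxx.
Qed.

Lemma independent_delta (m : nat) (j k : 'I_m) : j != k ->
  independent (delta_mx j 0) (delta_mx k 0).
Proof.
move=> jk a b /colP ab; have := ab j; have := ab k.
rewrite !mxE !eqxx (negPf jk) [k == j]eq_sym (negPf jk) /=.
by rewrite !mulr0 !mulr1 add0r addr0.
Qed.

Lemma stages_exist (R : realType) (m : nat) (eps : nat -> R)
    (T : nat -> nat) : (3 <= m)%N ->
  (forall n, (0 < n)%N -> 0 < eps n) ->
  exists (Theta : 'rV[R]_m) (u : nat -> 'cV[int]_m)
      (p : nat -> nat -> 'cV[int]_m),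
    height (u 0%N) = 1%N /\
    forall n, [/\ u n != 0, p n 0%N = u n,
      forall i, (i <= T (height (u n)))%N ->
        (height (p n i) <= height (u n.+1))%N,
      descent Theta (p n) (T (height (u n))) &
      zeta Theta (u n) <= eps (height (u n.+2))].
Proof.
move=> m3 eps0.
pose S := ('rV[R]_m * R * 'cV[int]_m * 'cV[int]_m * (nat -> 'cV[int]_m))%type.
pose c (s : S) := s.1.1.1.1.
pose r (s : S) := s.1.1.1.2.
pose u (s : S) := s.1.1.2.
pose w (s : S) := s.1.2.
pose p (s : S) := s.2.
pose good s := 0 < r s /\ stage (c s) (u s) (w s) (p s) (T (height (u s))).
(* The inequalities are required on the whole new box, so the common point of all boxes inherits
   them. *)
pose next s s' := [/\ good s', u s' = w s &
  forall Theta, closed_box (c s') (r s') Theta ->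
    [/\ closed_box (c s) (r s) Theta, descent Theta (p s) (T (height (u s))) &
        zeta Theta (u s) <= eps (height (w s'))]].
have /choice[f fP] s : exists s', good s -> next s s'.
  have [[r0 st]|] := pselect (good s); last by exists s.
  have [Phi [w2 [p2 [st2 near2]]]] := stage_step (T (height (w s))) m3 eps0
    st (nbhs_closed_box (c s) r0).
  have [r2 r20 h] := closed_box_nbhs near2.
  by exists (Phi, r2, w s, w2, p2) => _; split.
(* The start is the zero form, with integer values everywhere, and two unit vectors. *)
have [s0 [s0good s0u]] : exists s0, good s0 /\ height (u s0) = 1%N.
  pose j : 'I_m := Ordinal (ltnW (ltnW m3)); pose k : 'I_m := Ordinal (ltnW m3).
  have jk : j != k by [].
  have form0 x : linear_form (0 : 'rV[R]_m) x \is a Num.int.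
    by rewrite -(scale0r 0) linear_formZl mul0r.
  have [w0 [p0 [a [b [_ _ h]]]]] :=
    @stage_exists R m _ _ (T 1%N) (independent_delta jk).
  have [Phi _ st] := h 0 setT (form0 _) (form0 _) openT I.
  exists (Phi, 1, delta_mx j 0, w0, p0); split; last exact: height_delta.
  by split; rewrite /r /c /u /w /p /= ?height_delta.
pose s n := iter n f s0.
have sgood n : good (s n).
  by elim: n => [//|n IH]; have [] := fP (s n) IH.
have snext n : next (s n) (s n.+1) by exact: fP.
have [|n|Theta box] := @nested_boxes R m (c \o s) (r \o s).
- by move=> n; have [] := sgood n.
- by move=> Theta /=; have [_ _ h] := snext n => /h[].
exists Theta, (u \o s), (p \o s); split=> //= n.
have [_ uw h] := snext n; have [_ st] := sgood n.
have [_ desc zu] := h _ (box n.+1).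
split=> //.
- exact: independent_neq0 (stage_independent st).
- exact: stage_start st.
- by move=> i iT; rewrite -/(s n.+1) uw; exact: stage_height st i iT.
- by have [_ uw' _] := snext n.+1; rewrite -[f (f _)]/(s n.+2) uw'.
Qed.

Theorem theorem68 (R : realType) (m : nat) (hm : (3 <= m)%N)
    (psi : R -> R)
    (psi_gt0 : forall t : R, 1 <= t -> 0 < psi t)
    (psi_decr : forall s t : R, 1 <= s -> s <= t -> psi t <= psi s)
    (psi_cvg0 : psi t @[t --> +oo] --> 0)
    (tau : nat -> nat)
    (tau_cvg : tau nu @[nu --> \oo] --> \oo) :
  exists Theta : 'rV[R]_m,
    Z_independent_with_1 Theta /\
    exists (M_ : nat -> nat) (zeta_ : nat -> R),
      best_approximation_sequences Theta M_ zeta_ /\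
      forall nu : nat, (1 <= nu)%N ->
        zeta_ nu <= psi (M_ (nu + tau nu)%N)%:R.
Proof.
(* The maximum covers all indices up to [h]; the successor gives each descent at least one step. *)
pose T h := (\max_(nu < h.+1) tau nu).+1.
have tauT nu h : (nu <= h)%N -> (tau nu <= T h)%N.
  rewrite -ltnS => nuh; rewrite ltnW// ltnS.
  exact: (leq_bigmax (F := fun nu : 'I_h.+1 => tau nu) (Ordinal nuh)).
have [|Theta [u [p [u0h stages]]]] :=
  @stages_exist R m (fun n => psi n%:R) T hm.
  by move=> n n0; apply: psi_gt0; rewrite ler1n.
(* [p n 1] is higher than [u n], since otherwise it would beat itself. *)
have uS n : (height (u n) < height (u n.+1))%N.
  have [un0 p0 ph desc _] := stages n.
  rewrite -p0 (leq_trans _ (ph 1%N _))// ltnNge; apply/negP.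
  have [p1 pmin] := desc 0%N isT.
  by move=> /(pmin _ p1); rewrite ltxx.
have u_large H : (H <= height (u H))%N.
  by elim: H => // H IH; exact: leq_ltn_trans IH (uS H).
have inf H : exists2 y, y != 0 & forall x, x != 0 -> (height x <= H)%N ->
    zeta Theta y < zeta Theta x.
  have [_ p0 _ /(_ 0%N isT)[p1 pmin] _] := stages H.
  exists (p H 1%N) => // x x0 xH; apply: pmin => //.
  by rewrite p0 (leq_trans xH).
have pos x : x != 0 -> 0 < zeta Theta x.
  move=> x0; have [y _ h] := inf (height x).
  exact: le_lt_trans (zeta_ge0 _ _) (h x x0 (leqnn _)).
exists Theta; split.
  (* An integer relation with [x] nonzero would give [zeta Theta x = 0]. *)
  move=> a x ax0; have x0 : x = 0.
    apply/eqP; apply: contraTT isT => /pos.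
    rewrite zeta_gt0 => /negP[].
    have -> : linear_form Theta x = (- a)%:~R by rewrite rmorphN /=; lra.
    exact: intr_int.
  move: ax0; rewrite x0 linear_form0r addr0 => /eqP.
  by rewrite intr_eq0 => /eqP.
have [M_ [zeta_ seqs]] := best_approximation_sequences_exist pos inf.
exists M_, zeta_; split=> // nu nu1.
have large : exists n, (M_ nu < height (u n))%N.
  by exists (M_ nu).+1; exact: u_large.
(* Index 0 is excluded because [height (u 0) = 1] is at most [M_ nu]; minimality then places [M_ nu]
   between [height (u k)] and [height (u k.+1)]. *)
have [[|k] Mu umin] := ex_minnP large.
  by move: Mu; rewrite u0h ltnNge (leq_trans nu1 (leq_M seqs nu1)).
have uM : (height (u k) <= M_ nu)%N.
  by rewrite leqNgt; apply/negP => /umin; rewrite ltnn.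
have [uk0 _ _ _ zu] := stages k.
have [x [xbest xM <-]] := best_value seqs nu1.
apply: (le_trans (xbest.2 _ uk0 _)); first by rewrite xM.
apply: (le_trans zu); apply: psi_decr.
  by rewrite ler1n (leq_trans _ (leq_M seqs _)) ?addn_gt0 ?nu1.
(* The descent from [u k.+1], which is higher than [M_ nu], has at least [tau nu] steps, since [nu]
   is at most [height (u k.+1)]. *)
have [_ p0 ph desc _] := stages k.+1.
have tau_le : (tau nu <= T (height (u k.+1)))%N.
  by apply: tauT; rewrite (leq_trans (leq_M seqs nu1))// ltnW.
rewrite ler_nat (leq_trans _ (ph _ tau_le))//.
by apply: (descent_M seqs desc nu1 _ tau_le); rewrite p0 ltnW.
Qed.
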